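(* Let $X_1$, $X_2$, $Y$ be Banach spaces, $G\subset X:= X_1 \times X_2$ an open set and $f: G \to Y$ a mapping which is continuous with respect to the second variable (i.e. all partial mappings $f(a_1,\cdot)$, $(a_1,a_2) \in G$, are continuous). Then the set $$D_1(f):= \{x \in G:\ f_1'(x) \ \text{exists}\}$$ is an $F_{\sigma \delta\sigma}$ set. If $G=X$, then $D_1(f)$ is an $F_{\sigma \delta}$ set.
   Context: All Banach spaces are real and nontrivial ($\neq\{0\}$). $X_1\times X_2$ is equipped with the maximum norm. For $x=(x_1,x_2)\in G$, $f'_1(x)$ denotes the partial Fréchet derivative of $f$ at $x$ with respect to the first variable, i.e. (if it exists) the Fréchet derivative at $x_1$ of the mapping $t\mapsto f(t,x_2)$, defined for those $t\in X_1$ with $(t,x_2)\in G$; it is an element of the space of continuous linear mappings $X_1\to Y$. The partial mapping $f(a_1,\cdot)$ is defined on $\{t\in X_2:(a_1,t)\in G\}$. An $F_\sigma$ set is a countable union of closed sets, an $F_{\sigma\delta}$ set is a countable intersection of $F_\sigma$ sets, and an $F_{\sigma\delta\sigma}$ set is a countable union of $F_{\sigma\delta}$ sets (all in $X$). *)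

(* Defs.v *)
From HB Require Import structures.
From mathcomp Require Import all_boot all_order all_algebra.
From mathcomp Require Import all_classical all_reals all_analysis.
From mathcomp Require Import borel_hierarchy.

Set Implicit Arguments.
Unset Strict Implicit.
Unset Printing Implicit Defensive.

Import Order.TTheory GRing.Theory Num.Theory.
Import numFieldNormedType.Exports.

Local Open Scope classical_set_scope.
Local Open Scope ring_scope.

Definition Fsigmadelta (T : topologicalType) (S : set T) : Prop :=
  exists2 F : (set T)^nat, (forall i, Fsigma (F i)) & S = \bigcap_i F i.

Definition Fsigmadeltasigma (T : topologicalType) (S : set T) : Prop :=
  exists2 F : (set T)^nat, (forall i, Fsigmadelta (F i)) & S = \bigcup_i F i.

(* A mapping G -> Y is represented by a total function f, whose values outside
   G are irrelevant.  Here t |-> f (t, x.2) is restricted to no domain: G is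
   meant to be open, so its Fréchet differentiability at a point x.1 with
   G x only depends on the values of f on G. *)
Definition D1 (R : realType) (X1 X2 Y : normedModType R)
    (G : set (X1 * X2)) (f : X1 * X2 -> Y) : set (X1 * X2) :=
  [set x | G x /\ differentiable (fun t : X1 => f (t, x.2)) x.1].

Definition continuous_in_second (R : realType) (X1 X2 Y : normedModType R)
    (G : set (X1 * X2)) (f : X1 * X2 -> Y) : Prop :=
  forall (a1 : X1) (a2 : X2), G (a1, a2) ->
    {within [set t : X2 | G (a1, t)], continuous (fun t : X2 => f (a1, t))}.

(* Main.v *)
(* Differentiability at [x] in the first variable holds iff for every [e > 0]
   there is a bounded linear [L], depending on [e], with
   [|f (x.1 + h, x.2) - f x - L h| <= e |h|] for small [h].  Let [A(C, d, e)] be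
   the set of those [x] for which some [L] of norm at most [C] works for
   [|h| < d].  This set is not closed, but for [x] in its closure, continuity in
   the second variable carries enough of the estimate over to [x]: on any finite
   set of small vectors the increment [D h = f (x.1 + h, x.2) - f x] is within
   [e |h|] (up to an arbitrarily small constant) of a linear map of norm at most
   [C].  The linear map may change with the finite set, yet three vectors suffice
   to see that [D] is bounded by a multiple of [|h|] and that
   [|D (s u + v) - s D u - D v| <= 2 e (|s| |u| + |v|)].  If this happens for
   every [e], then [L v = lim D (t v) / t] exists by completeness and is the
   derivative.  Hence, up to restriction to the closed set of points whose
   [r]-ball lies in [G], [D1] is the intersection over [e = 1/k] of the unions
   over [n] of the closures of [A(n, 1/n, 1/k)]; the last countable union is over
   [r = 1/j], and it is not needed when [G] is the whole space. *)
Require Import Defs.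
From HB Require Import structures.
From mathcomp Require Import all_boot all_order all_algebra.
From mathcomp Require Import all_classical all_reals all_analysis.
From mathcomp Require Import borel_hierarchy ring lra.

Import Order.TTheory GRing.Theory Num.Theory.
Set Implicit Arguments.
Unset Strict Implicit.
Unset Printing Implicit Defensive.
Import numFieldNormedType.Exports.

Local Open Scope classical_set_scope.
Local Open Scope ring_scope.

(** * Fréchet derivatives and approximately linear maps *)

Lemma cvg_norm_le (R : realType) (V : normedModType R) (T : Type)
    (F : set_system T) {FF : ProperFilter F} (u : T -> V) (l : V) (M : R) :
  u @ F --> l -> (\forall t \near F, `|u t| <= M) -> `|l| <= M.
Proof.
move=> /cvg_norm ul uM.
have <- : lim ((fun t => `|u t|) @ F) = `|l| by apply: cvg_lim.
by apply: limr_le => //; apply/cvg_ex; exists `|l|.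
Qed.

(** The bound on [L] encodes the continuity of the differential, which linearity alone does not give
    in infinite dimension. *)
Lemma differentiable_epsP (R : realType) (V W : normedModType R)
    (g : V -> W) (x : V) :
  differentiable g x <->
  exists L : {linear V -> W}, (exists C : R, forall v, `|L v| <= C * `|v|) /\
    forall e : R, 0 < e -> exists2 r : R, 0 < r &
      forall h, `|h| < r -> `|g (x + h) - g x - L h| <= e * `|h|.
Proof.
have nbhs0P (P : V -> Prop) : (\forall h \near (0 : V), P h) <->
    exists2 r : R, 0 < r & forall h, `|h| < r -> P h.
  split=> [/nbhs_ballP[r r0 rP]|[r r0 rP]].
    by exists r => // h hr; apply: rP; rewrite -ball_normE /ball_ /= sub0r normrN.
  apply/nbhs_ballP; exists r => // h; rewrite -ball_normE /ball_ /= sub0r normrN.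
  exact: rP.
have expand (L : {linear V -> W}) : (g \o shift x = cst (g x) + L +o_ 0 id) <->
    forall e : R, 0 < e -> exists2 r : R, 0 < r &
      forall h, `|h| < r -> `|g (x + h) - g x - L h| <= e * `|h|.
  split.
    move=> /eqaddoP gL e /gL /nbhs0P[r r0 rL]; exists r => // h /rL.
    by rewrite /= !fctE /= opprD addrA [h + x]addrC.
  move=> gL; apply/eqaddoP => e /gL[r r0 rL]; apply/nbhs0P; exists r => // h /rL.
  by rewrite /= !fctE /= opprD addrA [h + x]addrC.
split.
  move=> /diff_locallyP[dc /expand dE]; exists ('d g x); split=> //.
  have /linear_boundedP[M [Mreal ML]] := (linear_bounded_continuous _).2 dc.
  by exists (M + 1) => v; apply: ML; rewrite ltrDl.
move=> [L [[C LC] /expand gL]].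
have Lc : continuous L.
  apply/linear_bounded_continuous/linear_boundedP.
  exists C; split; first exact: num_real.
  by move=> r Cr v; apply: (le_trans (LC v)); rewrite ler_wpM2r// ltW.
have dL := diff_unique Lc gL.
by apply/diff_locallyP; rewrite dL.
Qed.

Lemma approx_linear_limit (R : realType) (V : normedModType R)
    (W : completeNormedModType R) (D : V -> W) :
  D 0 = 0 ->
  (exists C : R, exists2 r : R, 0 < r &
    forall v, `|v| < r -> `|D v| <= C * `|v|) ->
  (forall e : R, 0 < e -> exists2 r : R, 0 < r & forall (s : R) u v,
    `|u| < r -> `|v| < r -> `|s *: u + v| < r ->
    `|D (s *: u + v) - s *: D u - D v| <= e * (`|s| * `|u| + `|v|)) ->
  exists L : {linear V -> W}, (exists C : R, forall v, `|L v| <= C * `|v|) /\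
    forall e : R, 0 < e -> exists2 r : R, 0 < r &
      forall h, `|h| < r -> `|D h - L h| <= e * `|h|.
Proof.
move=> D0 [C [r0 r0gt0 DC]] DP.
pose q v (t : R) := t^-1 *: D (t *: v).
have small (v : V) (r : R) : 0 < r -> \forall t \near (0 : R)^', `|t *: v| < r.
  move=> r_gt0; have v1 : 0 < `|v| + 1 by rewrite ltr_wpDl.
  near=> t; rewrite normrZ; apply: (@le_lt_trans _ _ (`|t| * (`|v| + 1))).
    by rewrite ler_wpM2l// lerDl.
  rewrite -ltr_pdivlMr//; near: t.
  exact: (dnbhs0_lt (V := R) (divr_gt0 r_gt0 v1)).
have nz : \forall t \near (0 : R)^', t != 0 by exact: nbhs_dnbhs_neq.
(* Apply the estimate to the vectors [t *: v] and [0] with scalar [s / t]: the error is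
   [e * |s| * |v|], and dividing by [s] leaves a bound independent of [s] and [t]. It yields both
   the Cauchy property and the final estimate. *)
have qB (e r : R) s (v : V) t : 0 < r ->
    (forall (s : R) u v,
    `|u| < r -> `|v| < r -> `|s *: u + v| < r ->
    `|D (s *: u + v) - s *: D u - D v| <= e * (`|s| * `|u| + `|v|)) ->
  s != 0 -> t != 0 -> `|s *: v| < r -> `|t *: v| < r ->
  `|q v s - q v t| <= e * `|v|.
  move=> r_gt0 Dr s0 t0 sr tr.
  have := Dr (s / t) (t *: v) 0.
  rewrite scalerA divfK// addr0 normr0 D0 subr0 addr0 => /(_ tr r_gt0 sr).
  rewrite (normrZ t v) (mulrA `|s / t|) -normrM divfK// => H.
  have -> : q v s - q v t = s^-1 *: (D (s *: v) - (s / t) *: D (t *: v)).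
    by rewrite /q scalerBr scalerA mulrA mulVf// mul1r.
  rewrite normrZ normfV ler_pdivrMl ?normr_gt0//.
  by apply: (le_trans H); rewrite mulrCA.
have qcvg v : cvg (q v @ (0 : R)^').
  apply/cauchy_cvgP/cauchy_exP => e e0.
  have v1 : 0 < `|v| + 1 by rewrite ltr_wpDl.
  have [r r_gt0 Dr] := DP (e / (`|v| + 1)) (divr_gt0 e0 v1).
  have [s [s0 sr]] := filter_ex (filterI nz (small v r r_gt0)).
  exists (q v s).
  suff : \forall t \near (0 : R)^', ball (q v s) e (q v t) by [].
  near=> t; rewrite -ball_normE /=.
  apply: (@le_lt_trans _ _ (e / (`|v| + 1) * `|v|)).
    apply: (qB _ _ _ _ _ r_gt0 Dr s0) => //.
    - by near: t.
    - by near: t; exact: small.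
  by rewrite mulrAC ltr_pdivrMr// ltr_pM2l// ltrDl.
pose L v := lim (q v @ (0 : R)^').
have qL v : q v @ (0 : R)^' --> L v by exact: qcvg.
have Llin : linear L.
  move=> a u v; apply/eqP; rewrite -subr_eq0 -normr_le0.
  apply/ler_addgt0Pl => e e0; rewrite addr0.
  have K0 : 0 < `|a| * `|u| + `|v| + 1 by rewrite ltr_wpDl// addr_ge0// mulr_ge0.
  have [r r_gt0 Dr] := DP _ (divr_gt0 e0 K0).
  have cv : (q (a *: u + v) - (a *: q u + q v)) @ (0 : R)^' -->
      L (a *: u + v) - (a *: L u + L v).
    by apply: cvgB => //; apply: cvgD => //; exact: cvgZr.
  apply: (cvg_norm_le cv); near=> t.
  have t0 : t != 0 by near: t.
  have tu : `|t *: u| < r by near: t; exact: small.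
  have tv : `|t *: v| < r by near: t; exact: small.
  have ta : `|t *: (a *: u + v)| < r by near: t; exact: small.
  have E : t *: (a *: u + v) = a *: (t *: u) + t *: v.
    by rewrite scalerDr !scalerA mulrC.
  rewrite E in ta.
  have := Dr _ _ _ tu tv ta.
  rewrite !fctE /q E (normrZ t u) (normrZ t v) (mulrCA `|a|) -mulrDr.
  have -> : t^-1 *: D (a *: (t *: u) + t *: v) - (a *: (t^-1 *: D (t *: u)) +
      t^-1 *: D (t *: v)) =
      t^-1 *: (D (a *: (t *: u) + t *: v) - a *: D (t *: u) - D (t *: v)).
    by rewrite !scalerBr !scalerA opprD addrA [a / t]mulrC.
  rewrite normrZ normfV ler_pdivrMl ?normr_gt0// => /le_trans; apply.
  rewrite mulrCA ler_pM2l ?normr_gt0// mulrAC ler_pdivrMr//.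
  by rewrite ler_pM2l// lerDl.
pose Lm := GRing.isLinear.Build R V W _ L Llin.
pose L' : {linear V -> W} := HB.pack L Lm.
exists L'; split.
  exists C => v; apply: (cvg_norm_le (qL v)); near=> t.
  have t0 : t != 0 by near: t.
  have tv : `|t *: v| < r0 by near: t; exact: small.
  rewrite /q normrZ normfV ler_pdivrMl ?normr_gt0// mulrCA -normrZ.
  exact: DC.
move=> e e0; have [r r_gt0 Dr] := DP e e0.
exists r => // h hr; rewrite distrC.
have cv : (q h - cst (D h)) @ (0 : R)^' --> L h - D h.
  by apply: cvgB => //; exact: cvg_cst.
apply: (cvg_norm_le cv); near=> t.
(* The radius depends on [e] only, so [h] itself is admissible: compare the quotients at [1] and at
   [t], then let [t] tend to 0. *)
rewrite !fctE; have -> : D h = q h 1 by rewrite /q invr1 !scale1r.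
apply: (qB _ r) => //.
- by near: t.
- by near: t; exact: small.
- by rewrite scale1r.
Unshelve. all: by end_near. Qed.

(** * Estimates at points of the closure *)

Lemma subrACA (V : zmodType) (x y z t : V) : x - y - (z - t) = x - z - (y - t).
Proof. by rewrite opprD addrACA -opprD. Qed.

Definition almost_linear (R : realType) (X1 X2 Y : normedModType R)
    (f : X1 * X2 -> Y) (C d e : R) : set (X1 * X2) :=
  [set x | exists L : {linear X1 -> Y}, (forall v, `|L v| <= C * `|v|) /\
    forall h, `|h| < d -> `|f (x.1 + h, x.2) - f x - L h| <= e * `|h|].

(* [L] is borrowed from a nearby point [(a', b')] of the set: comparing its
   estimates at [a + u] and at [a] eliminates the base value [f (a', b')], on
   which nothing is known since [f] need not be continuous in the first
   variable. *)
Lemma closure_almost_linear (R : realType) (X1 X2 Y : normedModType R)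
    (f : X1 * X2 -> Y) (C d e : R) (A : set (X1 * X2)) (a : X1) (b : X2)
    (s : seq X1) (eta : R) :
  0 <= e -> 0 < d -> 0 < eta -> A `<=` almost_linear f C d e ->
  closure A (a, b) ->
  (forall u, u \in 0 :: s -> `|u| < d / 2 /\
    {for b, continuous (fun t => f (a + u, t))}) ->
  exists L : {linear X1 -> Y}, (forall v, `|L v| <= C * `|v|) /\
    forall u, u \in s -> `|f (a + u, b) - f (a, b) - L u| <= e * `|u| + eta.
Proof.
move=> e0 d0 eta0 Af cl us.
have eta4 : 0 < eta / 4 by rewrite divr_gt0.
have e1 : 0 < e + 1 by rewrite ltr_wpDl.
(* The first bound keeps [a - a'] and [a + u - a'] shorter than [d]; the second makes the cost
   [e * sigma] of moving the base point at most [eta / 4]. The [+ 1] covers [e = 0]. *)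
pose sigma := Num.min (d / 2) (eta / 4 / (e + 1)).
have sigma0 : 0 < sigma by rewrite lt_min !divr_gt0.
(* Finiteness of [s] gives a common neighbourhood; the entry [0] stands for the base point [a]. *)
have near_f : \forall t \near b, forall u, u \in 0 :: s ->
    `|f (a + u, b) - f (a + u, t)| < eta / 4.
  have {cl} : forall u, u \in 0 :: s -> {for b, continuous (fun t => f (a + u, t))}.
    by move=> u /us[].
  elim: (0 :: s) => [|v s' IH] fc; first by near=> t.
  have {}IH := IH (fun u us' => fc u (mem_behead (s := v :: s') us')).
  have /cvgrPdist_lt /(_ _ eta4) fv := fc v (mem_head _ _).
  near=> t => u; rewrite inE => /predU1P[->|us']; first by near: t.
  by move: u us'; near: t.
have nbhs_ab : nbhs (a, b) [set x | `|x.1 - a| < sigma /\ forall u,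
    u \in 0 :: s -> `|f (a + u, b) - f (a + u, x.2)| < eta / 4].
  exists (ball a sigma, [set t | forall u, u \in 0 :: s ->
    `|f (a + u, b) - f (a + u, t)| < eta / 4]).
    by split=> //=; exact: nbhsx_ballx.
  by move=> [y t] [/=]; rewrite -ball_normE /= distrC.
have [[a' b'] [/Af[L [LC Lf]] [/= aa' fb']]] := cl _ nbhs_ab.
exists L; split=> // u u_s.
have [ud _] := us u (mem_behead (s := 0 :: s) u_s).
have du := fb' u (mem_behead (s := 0 :: s) u_s).
have := fb' 0 (mem_head _ _); rewrite addr0 => da.
have sd : sigma <= d / 2 by rewrite ge_min lexx.
have s4 : e * sigma <= eta / 4.
  apply: (@le_trans _ _ ((e + 1) * sigma)); first by rewrite ler_wpM2r ?ltW// ltrDl.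
  by rewrite mulrC -ler_pdivlMr// ge_min lexx orbT.
have La := Lf (a - a'); have Lu := Lf (a + u - a').
rewrite /= subrKC in La; rewrite /= subrKC in Lu.
have aa : `|a - a'| < sigma by rewrite distrC.
have ua : `|a + u - a'| <= `|u| + sigma.
  rewrite addrAC addrC; apply: (le_trans (ler_normD _ _)).
  by rewrite lerD2l ltW.
have {}La : `|f (a, b') - f (a', b') - L (a - a')| <= eta / 4.
  apply: le_trans s4; apply: le_trans (La _) _; first by lra.
  by rewrite ler_wpM2l// ltW.
have {}Lu : `|f (a + u, b') - f (a', b') - L (a + u - a')| <= e * `|u| + eta / 4.
  apply: (@le_trans _ _ (e * (`|u| + sigma))).
    by apply: le_trans (Lu _) _; [lra | rewrite ler_wpM2l].
  by rewrite mulrDr lerD2l.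
have -> : f (a + u, b) - f (a, b) - L u =
    (f (a + u, b) - f (a + u, b')) - (f (a, b) - f (a, b')) +
    (f (a + u, b') - f (a', b') - L (a + u - a')) -
    (f (a, b') - f (a', b') - L (a - a')).
  have -> : L u = L (a + u - a') - L (a - a').
    by rewrite -linearB; congr (L _); rewrite opprB addrA subrK addrC addKr.
  rewrite [in RHS]subrACA -[RHS]addrA (subrACA _ (L _)) (subrACA (f (a + u, b'))).
  by rewrite subrr subr0 addrA subrK.
apply: (le_trans (ler_normB _ _)).
apply: (le_trans (lerD (ler_normD _ _) (lexx _))).
apply: (le_trans (lerD (lerD (ler_normB _ _) (lexx _)) (lexx _))).
lra.
Unshelve. all: by end_near. Qed.

(** * Borel class of the set of differentiability points *)

(** A point [y] of the ball around [x] lies in the ball around every centre closer to [x] than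
    [r - |x - y|]. *)
Lemma closed_ball_subset (R : realType) (V : normedModType R) (G : set V) (r : R) :
  closed [set x | ball x r `<=` G].
Proof.
move=> x cl y; rewrite -ball_normE /= => xy.
have d0 : 0 < r - `|x - y| by rewrite subr_gt0.
have [z [/= zG]] := cl _ (nbhsx_ballx x _ d0).
rewrite -ball_normE /= => xz; apply: zG; rewrite -ball_normE /=.
by rewrite -(subrKA x); apply: (le_lt_trans (ler_normD _ _)); rewrite -ltrBrDr distrC.
Qed.

Lemma continuous_second (R : realType) (X1 X2 Y : normedModType R)
    (G : set (X1 * X2)) (f : X1 * X2 -> Y) (a : X1) (b : X2) :
  open G -> continuous_in_second G f -> G (a, b) ->
  {for b, continuous (fun t => f (a, t))}.
Proof.
move=> oG fc Gab.
have oS : open [set t | G (a, t)].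
  apply: (open_comp (f := fun t => (a, t))) oG => t _.
  by apply: cvg_pair; [exact: cvg_cst | exact: cvg_id].
have := fc a b Gab; rewrite (continuous_open_subspace _ oS) => /(_ b).
by apply; rewrite inE.
Qed.

(** Fixing [r] keeps limit points inside [G], with [f (a + u, _)] continuous at [b] whenever
    [|u| < r]. *)
Lemma D1_inner (R : realType) (X1 X2 : normedModType R)
    (Y : completeNormedModType R) (G : set (X1 * X2)) (f : X1 * X2 -> Y) (r : R) :
  open G -> continuous_in_second G f -> 0 < r ->
  D1 G f `&` [set x | ball x r `<=` G] =
  \bigcap_k \bigcup_n closure ([set x | ball x r `<=` G] `&`
    almost_linear f n.+1%:R n.+1%:R^-1 k.+1%:R^-1).
Proof.
move=> oG fc r0; apply/seteqP; split=> [x [[Gx /differentiable_epsP]]|[a b] H].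
  move=> [L [[C LC] Lf]] xr k _.
  have [d d0 Ld] := Lf k.+1%:R^-1 ltac:(by rewrite invr_gt0).
  (* One index must bound the norm and, inverted, the radius. *)
  have [n Cn dn] : exists2 n, C <= n.+1%:R & n.+1%:R^-1 <= d.
    have := truncnS_gt (Num.max C d^-1); rewrite gt_max => /andP[CM dM].
    exists (Num.trunc (Num.max C d^-1)); first exact: ltW.
    by rewrite -[leRHS]invrK lef_pV2 ?posrE ?invr_gt0// ltW.
  exists n => //; apply: subset_closure; split=> //; exists L; split.
    by move=> v; apply: (le_trans (LC v)); rewrite ler_wpM2r.
  move=> h hn; have := Ld h (lt_le_trans hn dn).
  by case: (x).
set E := [set x | ball x r `<=` G] in H *.
have Eab : E (a, b).
  have [n _ cl] := H 0%N I.
  by apply: closed_ball_subset; apply: (closure_subset _ cl) => x [].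
have Gab : G (a, b) by apply: Eab; exact: ballxx.
split=> //; split=> //.
have cont u : `|u| < r -> {for b, continuous (fun t => f (a + u, t))}.
  move=> ur; apply: continuous_second oG fc _; apply: Eab.
  by split; [rewrite -ball_normE /= opprD addNKr normrN | exact: ballxx].
pose D h := f (a + h, b) - f (a, b).
have approx k : exists C : R, exists2 d : R, 0 < d &
    forall (s : seq X1) (eta : R), 0 < eta -> (forall u, u \in s -> `|u| < d) ->
    exists L : {linear X1 -> Y}, (forall v, `|L v| <= C * `|v|) /\
      forall u, u \in s -> `|D u - L u| <= k.+1%:R^-1 * `|u| + eta.
  have [n _ cl] := H k I.
  have n0 : 0 < n.+1%:R^-1 :> R by rewrite invr_gt0.
  exists n.+1%:R, (Num.min (n.+1%:R^-1 / 2) r); first by rewrite lt_min divr_gt0.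
  move=> s eta eta0 sd.
  have k0 : 0 <= k.+1%:R^-1 :> R by rewrite invr_ge0.
  apply: (closure_almost_linear k0 n0 eta0 (@subIsetr _ _ _) cl).
  move=> u; rewrite inE => /predU1P[->|/sd].
    by rewrite normr0 divr_gt0//; split=> //; apply: cont; rewrite normr0.
  by rewrite lt_min => /andP[ud ur]; split=> //; exact: cont.
have [||| L [LC Lf]] := @approx_linear_limit R X1 Y D.
- by rewrite /D addr0 subrr.
- have [C [d d0 Cd]] := approx 0%N.
  exists (C + 1), d => // v vd.
  apply/ler_addgt0Pl => eta eta0; rewrite addrC.
  have [|L [LC Lf]] := Cd [:: v] eta eta0; first by move=> u; rewrite inE => /eqP ->.
  have := Lf v (mem_head _ _); rewrite invr1 mul1r => Lv.
  rewrite -(subrK (L v) (D v)); apply: (le_trans (ler_normD _ _)).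
  by have := LC v; lra.
- move=> e e0.
  (* Half of [e], because [|s *: u + v|] and [|s| * |u| + |v|] each contribute once. *)
  have [k ke] : exists k : nat, k.+1%:R^-1 <= e / 2.
    have e2 : 0 < e / 2 by rewrite divr_gt0.
    have [k] := ltr_add_invr e2; rewrite add0r => ke.
    by exists k; exact: ltW ke.
  have [C [d d0 Cd]] := approx k.
  exists d => // s u v ud vd wd.
  apply/ler_addgt0Pl => eta eta0.
  have K0 : 0 < 2 + `|s| by rewrite ltr_wpDr.
  (* All three vectors share one [L], so linearity cancels it. The tolerances enter with weights 1,
     [|s|] and 1, adding up to [eta]. *)
  have [|L [_ Lf]] := Cd [:: s *: u + v; u; v] (eta / (2 + `|s|)) (divr_gt0 eta0 K0).
    by move=> t; rewrite !inE => /or3P[]/eqP->.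
  have Lw := Lf (s *: u + v) ltac:(by rewrite !inE eqxx).
  have Lu := Lf u ltac:(by rewrite !inE eqxx orbT).
  have Lv := Lf v ltac:(by rewrite !inE eqxx !orbT).
  have -> : D (s *: u + v) - s *: D u - D v =
      (D (s *: u + v) - L (s *: u + v)) - s *: (D u - L u) - (D v - L v).
    rewrite (linearP L); move: (D _) (D _) (D _) => z y x.
    rewrite scalerBr (subrACA x) (subrACA (x - _)).
    by rewrite (addrAC _ (L v)) subrr add0r subrr subr0.
  apply: (le_trans (ler_normB _ _)).
  apply: (le_trans (lerD (ler_normB _ _) (lexx _))).
  rewrite normrZ.
  have suv : `|s *: u + v| <= `|s| * `|u| + `|v|.
    by rewrite -normrZ; exact: ler_normD.
  have s0 := normr_ge0 s; have u0 := normr_ge0 u; have v0 := normr_ge0 v.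
  have {}Lu := ler_wpM2l s0 Lu.
  apply: (le_trans (lerD (lerD Lw Lu) Lv)).
  have -> : k.+1%:R^-1 * `|s *: u + v| + eta / (2 + `|s|) +
      `|s| * (k.+1%:R^-1 * `|u| + eta / (2 + `|s|)) +
      (k.+1%:R^-1 * `|v| + eta / (2 + `|s|)) =
      k.+1%:R^-1 * (`|s *: u + v| + (`|s| * `|u| + `|v|)) + eta.
    by move: (k.+1%:R^-1) => c; field; rewrite gt_eqF.
  rewrite addrC lerD2l; set S := `|s| * `|u| + `|v| in suv *.
  have S0 : 0 <= S by rewrite addr_ge0// mulr_ge0.
  apply: (@le_trans _ _ (k.+1%:R^-1 * (2 * S))).
    by rewrite ler_wpM2l ?invr_ge0//; lra.
  by rewrite mulrA ler_wpM2r// -ler_pdivlMr.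
apply/differentiable_epsP; exists L; split=> // e /Lf[d d0 Ld]; by exists d.
Qed.

Theorem proposition3p3 (R : realType) (X1 X2 Y : completeNormedModType R)
    (X1_nontrivial : exists x : X1, x != 0)
    (X2_nontrivial : exists x : X2, x != 0)
    (Y_nontrivial : exists y : Y, y != 0)
    (G : set (X1 * X2)) (G_open : open G)
    (f : X1 * X2 -> Y) (f_cont2 : continuous_in_second G f) :
  Fsigmadeltasigma (D1 G f) /\ (G = setT -> Fsigmadelta (D1 G f)).
Proof.
have inner_Fsd r : 0 < r -> Fsigmadelta (D1 G f `&` [set x | ball x r `<=` G]).
  move=> r0; rewrite D1_inner//.
  eexists; last by [].
  by move=> k; eexists; last by []; move=> n; exact: closed_closure.
split.
  (* Since [G] is open, each of its points has a ball of some radius [1/(j+1)] inside [G]. *)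
  exists (fun j => D1 G f `&` [set x | ball x j.+1%:R^-1 `<=` G]).
    by move=> j; apply: inner_Fsd; rewrite invr_gt0.
  rewrite -setI_bigcupr; apply/esym/setIidPl => x [Gx _].
  have /nbhs_ballP[r /= r0 rG] := open_nbhs_nbhs (conj G_open Gx).
  have [j] := ltr_add_invr r0; rewrite add0r => jr.
  by exists j => // y /(le_ball (ltW jr)); exact: rG.
move=> GT; have := inner_Fsd 1 ltr01.
by rewrite (_ : [set x | _] = setT) ?setIT// GT; apply/seteqP; split.
Qed.
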